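(* Let $d\ge1$ and let $(Y_i)_{i\in\mathbb Z}$ be a strictly stationary sequence of random points, each uniformly distributed on $[0,1]^d$, with strong-mixing coefficients satisfying $\alpha(r)\le\varphi(r)$ for all $r\ge1$, where $\varphi:\mathbb N\to[0,\infty)$ satisfies $\sum_{r=0}^\infty r\,\varphi(r)<\infty$. Let $(c_a,p_a)_{a=1}^m$ be a finite collection of corner–point pairs. For $x\in\mathbb R^m$ define $Z_i(x)=\sum_{a=1}^m x_a\,\xi_{c_a,p_a}(Y_i)$ and $\gamma_x(r)=\mathrm{Cov}(Z_0(x),Z_r(x))$. Then for every $x\in\mathbb R^m$ $$\lim_{n\to\infty}\frac1n\mathrm{Var}\!\left(\sum_{i=0}^{n-1}Z_i(x)\right)=\sum_{r\in\mathbb Z}\gamma_x(r)=x^TSx\ge0,$$ where $S$ is the $m\times m$ matrix $$S_{a,b}=\sum_{r\in\mathbb Z}\mathrm{Cov}\bigl(\xi_{c_a,p_a}(Y_0),\,\xi_{c_b,p_b}(Y_r)\bigr).$$ In particular, $S$ is positive semidefinite.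
   Context: A corner of $[0,1]^d$ is a function $c:\{0,\dots,d-1\}\to\{\mathrm{true},\mathrm{false}\}$; a corner–point pair $(c,p)$ consists of a corner $c$ and a point $p\in[0,1]^d$. $\mathrm{cornerLe}(c,p)=\{s\in[0,1]^d:\ \text{for all }k,\ s_k\ge p_k\text{ if }c(k)=\mathrm{true},\ s_k\le p_k\text{ if }c(k)=\mathrm{false}\}$, and $F^c(p)=\prod_{k=0}^{d-1}g_k(p)$ with $g_k(p)=1-p_k$ if $c(k)=\mathrm{true}$ and $g_k(p)=p_k$ otherwise. $\xi_{c,p}(y)=\mathbf 1\{y\in\mathrm{cornerLe}(c,p)\}-F^c(p)$. For $r\ge1$, $\alpha(r)=\sup_{m\in\mathbb Z}\alpha\bigl(\sigma(Y_i:i\le m),\sigma(Y_i:i\ge m+r)\bigr)$, where $\alpha(\mathcal A,\mathcal B)=\sup\{|\mathbb P(A\cap B)-\mathbb P(A)\mathbb P(B)|:A\in\mathcal A,B\in\mathcal B\}$. *)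

(* Defs.v *)
From HB Require Import structures.
From mathcomp Require Export all_boot all_order all_algebra.
From mathcomp Require Export all_classical all_reals all_analysis.
Export Order.TTheory GRing.Theory Num.Theory.
Export numFieldNormedType.Exports.

Set Implicit Arguments.
Unset Strict Implicit.
Unset Printing Implicit Defensive.

Local Open Scope classical_set_scope.
Local Open Scope ring_scope.

(* Points of R^d are tuples [d.-tuple R]; the sigma-algebra on that type is
   the one generated by the coordinates, i.e. the Borel sigma-algebra. *)

Definition cube (R : realType) (d : nat) : set (d.-tuple R) :=
  [set s | forall k, 0 <= tnth s k <= 1].

Definition corner (d : nat) := 'I_d -> bool.

Definition cornerLe (R : realType) (d : nat) (c : corner d) (p : d.-tuple R) :
    set (d.-tuple R) :=
  [set s | cube s /\
    forall k, if c k then tnth p k <= tnth s k else tnth s k <= tnth p k].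

Definition cornerF (R : realType) (d : nat) (c : corner d) (p : d.-tuple R) : R :=
  \prod_(k < d) (if c k then 1 - tnth p k else tnth p k).

Definition xi (R : realType) (d : nat) (c : corner d) (p y : d.-tuple R) : R :=
  \1_(cornerLe c p) y - cornerF c p.

Section product_probability.
Local Open Scope ereal_scope.
Context d1 d2 (T1 : measurableType d1) (T2 : measurableType d2) (R : realType).
Variables (P1 : probability T1 R) (P2 : probability T2 R).

Definition product_probability : set (T1 * T2) -> \bar R := P1 \x P2.

HB.instance Definition _ := Measure.on product_probability.

Let product_probability_setT : product_probability setT = 1.
Proof.
rewrite /product_probability -setXTT product_measure1E//.
by rewrite -[RHS]mule1; congr (_ * _); exact: probability_setT.
Qed.

HB.instance Definition _ :=
  Measure_isProbability.Build _ _ _ product_probability product_probability_setT.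

End product_probability.

Section uniform_cube.
Variable R : realType.

Definition tuple_cons (n : nat) (x : measurableTypeR R * n.-tuple R) : n.+1.-tuple R :=
  [tuple of x.1 :: x.2].

Lemma measurable_tuple_cons (n : nat) :
  measurable_fun [set: measurableTypeR R * n.-tuple R] (@tuple_cons n).
Proof. exact: measurable_cons. Qed.

HB.instance Definition _ (n : nat) :=
  isMeasurableFun.Build _ _ _ _ (@tuple_cons n) (@measurable_tuple_cons n).

(* d-fold product of the uniform probability on [0, 1] *)
Fixpoint uniform_cube (d : nat) : probability (d.-tuple R) R :=
  match d with
  | 0 => \d_([tuple] : 0.-tuple R)
  | n.+1 => distribution
      (product_probability (uniform_prob (@ltr01 R)) (uniform_cube n))
      (@tuple_cons n)
  end.

End uniform_cube.

Section processes.
Context (dT : measure_display) (T : measurableType dT) (R : realType).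
Context (P : probability T R).
Context (dV : measure_display) (V : measurableType dV).

Definition strictly_stationary (Y : int -> {RV P >-> V}) : Prop :=
  forall (n : nat) (t : n.-tuple int) (h : int) (A : set (n.-tuple V)),
    measurable A ->
    P [set w | A [tuple Y (tnth t i + h) w | i < n]] =
    P [set w | A [tuple Y (tnth t i) w | i < n]].

Definition sigma_of (I : set int) (Y : int -> {RV P >-> V}) : set (set T) :=
  <<s \bigcup_(i in I) preimage_set_system setT (Y i) measurable >>.

Definition alpha_dep (A B : set (set T)) : \bar R :=
  ereal_sup [set `|P (C `&` D) - P C * P D|%E | C in A & D in B].

Definition alpha_mixing (Y : int -> {RV P >-> V}) (r : nat) : \bar R :=
  ereal_sup [set alpha_dep (sigma_of [set i | i <= m] Y)
                           (sigma_of [set i | m + r%:Z <= i] Y) | m in setT].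

End processes.

(* Two-sided series of an absolutely summable family; a junk value otherwise. *)
Definition zsum (R : realType) (f : int -> \bar R) : \bar R :=
  (\esum_(r in [set: int]) f^\+ r - \esum_(r in [set: int]) f^\- r)%E.

Definition psd (R : realType) (m : nat) (A : 'M[R]_m) : Prop :=
  A^T = A /\ forall x : 'cV[R]_m, 0 <= (x^T *m A *m x) 0 0.

Section longrun.
Context (dT : measure_display) (T : measurableType dT) (R : realType).
Context (P : probability T R) (d m : nat) (Y : int -> {RV P >-> d.-tuple R}).
Context (c : 'I_m -> corner d) (p : 'I_m -> d.-tuple R).

Definition xi_cov (a b : 'I_m) (r : int) : \bar R :=
  covariance P (fun w => xi (c a) (p a) (Y 0 w)) (fun w => xi (c b) (p b) (Y r w)).

Definition longrun_cov : 'M[R]_m := \matrix_(a, b) fine (zsum (xi_cov a b)).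

Definition Zproc (x : 'cV[R]_m) (i : int) (w : T) : R :=
  \sum_(a < m) x a 0 * xi (c a) (p a) (Y i w).

Definition autocov (x : 'cV[R]_m) (r : int) : \bar R :=
  covariance P (Zproc x 0) (Zproc x r).

End longrun.

(* Main.v *)
(* Up to constants each [xi] is an indicator, so its covariance at lag [r] has
   the form [P (A `&` B) - P A * P B], at most [phi |r|] by strong mixing; hence
   all covariance series converge absolutely.  For a weakly stationary process
   with autocovariance [g], the variance [V n] of the first [n] terms satisfies
   [V n.+1 - V n = \sum_(-n <= r <= n) g r], so [V n / n] is a Cesaro mean of the
   symmetric partial sums of the series of [g] and has the same limit.  The
   quadratic form of [S] and its symmetry are obtained by passing to the limit in
   these symmetric partial sums, and [S] is nonnegative as a limit of variances. *)

From mathcomp Require Import zify.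
Require Import Defs.

Set Implicit Arguments.
Unset Strict Implicit.
Unset Printing Implicit Defensive.

Local Open Scope classical_set_scope.
Local Open Scope ring_scope.

Lemma cvg_weighted_sum (R : realType) (I : finType) (a l : I -> R)
    (f : I -> nat -> R) : (forall i, f i n @[n --> \oo] --> l i) ->
  \sum_i a i * f i n @[n --> \oo] --> \sum_i a i * l i.
Proof.
move=> fl; apply: cvg_big => [|i _]; last exact: cvgM (cvg_cst _) (fl i).
exact: add_continuous.
Qed.

(** * Two-sided series over the integers and their symmetric partial sums *)

Section int_sums.
Context {R : realType}.

(* [\sum_(-n <= r <= n) g r], as [Negz k] is [- k.+1]. *)
Definition symsum (g : int -> R) (n : nat) : R :=
  \sum_(0 <= k < n.+1) g k%:Z + \sum_(0 <= k < n) g (Negz k).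

Lemma esum_int (f : int -> \bar R) : (forall r, 0 <= f r)%E ->
  \esum_(r in [set: int]) f r =
  (\sum_(k <oo) f k%:Z + \sum_(k <oo) f (Negz k))%E.
Proof.
move=> f0; rewrite (esumID (range Posz))//; congr (_ + _)%E.
- rewrite setTI esum_image; last by move=> i j _ _ [].
  by rewrite nneseries_esumT//.
- rewrite setTI (_ : ~` range Posz = range Negz).
    by rewrite esum_image ?nneseries_esumT// => i j _ _ [].
  apply/seteqP; split=> [[k|k]//= h|_ [k _ <-] [? _]//].
  - by exfalso; apply: h; exists k.
  - by exists k.
Qed.

(** The negative half starts at [-1], so it is dominated by the series of [b] from index 1 on, which
    is at most the whole series. *)
Lemma summable_dominated_int (g : int -> R) (b : nat -> R) :
    (forall r : int, `|g r| <= b `|r|%N) ->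
    (\sum_(k <oo) (b k)%:E < +oo)%E ->
  summable [set: int] (EFin \o g).
Proof.
move=> gb bfin.
have b0 k : (0 <= (b k)%:E)%E.
  by rewrite lee_fin (le_trans _ (gb k%:Z)).
rewrite /summable esum_int//; apply: lte_add_pinfty.
- by apply: le_lt_trans bfin; apply: lee_nneseries => // k _; exact: gb.
- apply: le_lt_trans bfin.
  rewrite [leRHS]nneseries_recl//.
  apply: (@le_trans _ _ (\sum_(0 <= k <oo) (b k.+1)%:E)%E).
    by apply: lee_nneseries => // k _; exact: gb.
  under eq_eseriesr do rewrite -addn1; rewrite (nneseries_addn 1 (f := EFin \o b))//.
  exact: leeDr.
Qed.

(** Each half is an ordinary convergent series; the half of nonnegative indices has one more term in
    [symsum], which only shifts its partial sums. *)
Lemma cvg_symsum_ge0 (f : int -> \bar R) : (forall r, 0 <= f r)%E ->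
    (\esum_(r in [set: int]) f r < +oo)%E ->
  symsum (fine \o f) n @[n --> \oo] --> fine (\esum_(r in [set: int]) f r).
Proof.
move=> f0; rewrite esum_int// => ffin.
have half (e : nat -> int) : (\sum_(k <oo) f (e k) < +oo)%E ->
    \sum_(0 <= k < n) fine (f (e k)) @[n --> \oo]
      --> fine (\sum_(k <oo) f (e k))%E.
  move=> fe; have sfe : summable [set k : nat | xpredT k] (f \o e).
    rewrite /summable/= -nneseries_esum//.
    by under eq_eseriesr do rewrite gee0_abs//.
  rewrite summable_nneseries_lim//; exact: summable_cvg.
have [fP fN] : (\sum_(k <oo) f k%:Z < +oo)%E /\ (\sum_(k <oo) f (Negz k) < +oo)%E.
  by split; apply: le_lt_trans ffin; rewrite ?leeDl ?leeDr// nneseries_ge0.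
rewrite fineD ?ge0_fin_numE ?nneseries_ge0//.
apply: cvgD; last exact: half.
by have := half Posz fP; rewrite -cvg_shiftS.
Qed.

(** The nonnegative case applies separately to the positive and negative parts, whose sums [zsum]
    subtracts. Finiteness is recorded so that [fine] loses no information. *)
Lemma cvg_symsum (g : int -> R) : summable [set: int] (EFin \o g) ->
  symsum g n @[n --> \oo] --> fine (zsum (EFin \o g)) /\
  zsum (EFin \o g) \is a fin_num.
Proof.
move=> gfin.
have fpos : (\esum_(r in [set: int]) (EFin \o g)^\+ r < +oo)%E.
  have := summable_funepos gfin; rewrite /summable.
  by under eq_esum do rewrite gee0_abs//.
have fneg : (\esum_(r in [set: int]) (EFin \o g)^\- r < +oo)%E.
  have := summable_funeneg gfin; rewrite /summable.
  by under eq_esum do rewrite gee0_abs//.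
have fin1 : (\esum_(r in [set: int]) (EFin \o g)^\+ r)%E \is a fin_num.
  by rewrite ge0_fin_numE// esum_ge0.
have fin2 : (\esum_(r in [set: int]) (EFin \o g)^\- r)%E \is a fin_num.
  by rewrite ge0_fin_numE// esum_ge0.
split; last by rewrite /zsum fin_numB fin1.
rewrite /zsum fineB//.
rewrite (_ : symsum g = symsum (fine \o (EFin \o g)^\+%E) \-
                        symsum (fine \o (EFin \o g)^\-%E)).
  by apply: cvgB; exact: cvg_symsum_ge0.
have split_g r : g r = fine ((EFin \o g)^\+%E r) - fine ((EFin \o g)^\-%E r).
  rewrite -[LHS]/(fine ((EFin \o g) r)) [in LHS](funeposneg (EFin \o g)).
  by rewrite funeposE funenegE /= -!EFin_max.
apply/funext => n; rewrite /symsum /=.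
rewrite opprD addrACA -!sumrB.
  by congr (_ + _); apply: eq_bigr.
Qed.

Lemma symsum_sum (I : finType) (a : I -> R) (g : I -> int -> R) n :
  symsum (fun r => \sum_i a i * g i r) n = \sum_i a i * symsum (g i) n.
Proof.
rewrite /symsum exchange_big [X in _ + X]exchange_big -big_split/=.
by apply: eq_bigr => i _; rewrite mulrDr !mulr_sumr.
Qed.

(** Reflection fixes [0] and exchanges [k.+1] with [Negz k]. *)
Lemma symsumN (g h : int -> R) n : (forall r, g (- r) = h r) ->
  symsum g n = symsum h n.
Proof.
move=> gh; rewrite /symsum [X in X + _]big_nat_recl// [in RHS]big_nat_recl//=.
rewrite -(gh 0) oppr0 -!addrA; congr (_ + _).
rewrite addrC; congr (_ + _); apply: eq_bigr => k _.
  by rewrite -gh.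
by rewrite -gh NegzE opprK.
Qed.

Lemma cesaro_symsum (g : int -> R) (L : R) :
    symsum g n @[n --> \oo] --> L ->
  n%:R^-1 * (\sum_(i < n) \sum_(j < n) g (j%:Z - i%:Z)) @[n --> \oo] --> L.
Proof.
(* Enlarging the square of indices from [n] to [n.+1] adds a column with lags [1] to [n], a row with
   lags [-n] to [-1] and a corner with lag [0]: together, [symsum g n]. *)
have E n : \sum_(i < n) \sum_(j < n) g (j%:Z - i%:Z) = series (symsum g) n.
  rewrite seriesEnat/=; elim: n => [|n IH]; first by rewrite big_ord0 big_geq.
  rewrite big_nat_recr//= -IH big_ord_recr/=.
  under eq_bigr do rewrite big_ord_recr/=.
  rewrite big_split/= -addrA; congr (_ + _).
  rewrite /symsum big_ord_recr/= subrr addrCA addrA addrC.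
  rewrite big_nat_recl//= -addrA [X in g 0 + X]addrC !addrA.
  rewrite !big_mkord; congr (_ + _ + _).
  (* The new column and row run through their lags in the order opposite to that of [symsum]. *)
  - rewrite (reindex_inj rev_ord_inj)/=.
    by apply: eq_bigr => k _; congr g; have := ltn_ord k; lia.
  - rewrite (reindex_inj rev_ord_inj)/=.
    by apply: eq_bigr => k _; congr g; have := ltn_ord k; lia.
(* [cesaro] averages the first [n.+1] terms, hence the shift of the index. *)
move=> /cesaro gL; rewrite -cvg_shiftS; apply: cvg_trans gL.
by under eq_fun do rewrite E.
Qed.

End int_sums.

(** * Square integrability and bilinearity of the covariance *)

Section covariance_facts.
Context (dT : measure_display) (T : measurableType dT) (R : realType).
Context (P : probability T R).

Lemma Lfun2_indic (A : set T) : measurable A -> (\1_A : T -> R) \in Lfun P 2%:E.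
Proof.
move=> mA; rewrite inE; apply/andP; split; rewrite inE/=.
  exact: measurable_funTS.
rewrite /finite_norm unlock poweR_lty//.
under eq_integral => x _.
  have -> : (`|(EFin \o \1_A) x| `^ 2)%E = (\1_A x : R)%:E.
    rewrite /= indicE; case: (x \in A); rewrite ?normr1 ?normr0 ?powR1//.
    by rewrite powR0.
  over.
exact/integrable_lty/integrable_indic.
Qed.

(** Covariance ignores additive constants, and a product of indicators is the indicator of the
    intersection. What remains is the quantity that strong mixing controls. *)
Lemma covariance_indicB (A B : set T) (a b : R) : measurable A -> measurable B ->
  covariance P (fun w => \1_A w - a) (fun w => \1_B w - b) =
  (P (A `&` B) - P A * P B)%E.
Proof.
move=> mA mB.
have LA := Lfun2_indic mA; have LB := Lfun2_indic mB.
have L1 := Lfun_subset12 (fin_num_measure P _ measurableT).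
rewrite -[fun w => \1_A w - a]/(\1_A \- cst a).
rewrite -[fun w => \1_B w - b]/(\1_B \- cst b).
rewrite covarianceBl ?covariance_cst_l ?sube0 ?Lfun_cst//; last first.
  by rewrite rpredB//= ?Lfun_cst ?lee1n.
rewrite covarianceBr ?covariance_cst_r ?sube0 ?Lfun_cst//.
rewrite covarianceE ?Lfun2_mul_Lfun1 ?L1// !expectation_indic//.
by rewrite -[\1_A * \1_B]indicI expectation_indic//; exact: measurableI.
Qed.

Lemma Lfun2_sum (I : Type) (s : seq I) (a : I -> R) (X : I -> T -> R) :
    (forall i, X i \in Lfun P 2%:E) ->
  (fun w => \sum_(i <- s) a i * X i w) \in Lfun P 2%:E.
Proof.
move=> XL; elim: s => [|i s IH].
  by under eq_fun do rewrite big_nil; exact: Lfun_cst.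
under eq_fun do rewrite big_cons mulrC.
rewrite -[fun _ => _]/((a i \o* X i) + (fun w => \sum_(j <- s) a j * X j w)).
by rewrite rpredD//= ?lee1n ?Lfun_scale ?ler1n.
Qed.

Lemma covariance_suml (I : Type) (s : seq I) (a : I -> R) (X : I -> T -> R)
    (Z : T -> R) :
    (forall i, X i \in Lfun P 2%:E) -> Z \in Lfun P 2%:E ->
  covariance P (fun w => \sum_(i <- s) a i * X i w) Z =
  (\sum_(i <- s) (a i)%:E * covariance P (X i) Z)%E.
Proof.
move=> XL ZL; have L1 := Lfun_subset12 (fin_num_measure P _ measurableT).
elim: s => [|i s IH].
  under eq_fun do rewrite big_nil.
  by rewrite big_nil -[fun=> 0]/(cst 0) covariance_cst_l.
under eq_fun do rewrite big_cons mulrC.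
rewrite big_cons -IH -covarianceZl ?Lfun2_mul_Lfun1 ?L1//.
rewrite -covarianceDl ?Lfun2_sum//.
by rewrite Lfun_scale// ler1n.
Qed.

End covariance_facts.

(** * Second-order stationary processes and their linear combinations *)

Section second_order_stationary.
Context (dT : measure_display) (T : measurableType dT) (R : realType).
Context (P : probability T R).

Lemma variance_partial_sums (Z : int -> T -> R) (g : int -> R) :
    (forall i, Z i \in Lfun P 2%:E) ->
    (forall i j, covariance P (Z i) (Z j) = (g (j - i))%:E) ->
    summable [set: int] (EFin \o g) ->
  ((n%:R^-1)%:E * 'V_P[fun w => (\sum_(i < n) Z i%:Z w)%R])%E @[n --> \oo]
    --> zsum (EFin \o g).
Proof.
move=> ZL Zcov /cvg_symsum[gL gfin].
have V n : 'V_P[fun w => \sum_(i < n) Z i%:Z w] =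
    (\sum_(i < n) \sum_(j < n) g (j%:Z - i%:Z))%:E.
  (* Coefficients [1] are inserted to match [covariance_suml], which then expands both arguments,
     the second one through the symmetry of the covariance. *)
  rewrite /variance (_ : (fun w => _) =
      fun w => \sum_(i < n) 1 * Z i%:Z w); last first.
    by apply/funext => w; apply: eq_bigr => i _; rewrite mul1r.
  rewrite covariance_suml ?Lfun2_sum// -sumEFin; apply: eq_bigr => i _.
  rewrite mul1e covarianceC covariance_suml// -sumEFin.
  by apply: eq_bigr => j _; rewrite mul1e covarianceC Zcov.
under eq_fun do rewrite V -EFinM.
rewrite -(fineK gfin); apply: cvg_EFin; first exact: nearW.
exact: cesaro_symsum.
Qed.

Context (m : nat) (X : 'I_m -> int -> T -> R) (q : 'I_m -> 'I_m -> int -> R).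
Hypothesis XL : forall a i, X a i \in Lfun P 2%:E.
Hypothesis Xcov : forall a b i j,
  covariance P (X a i) (X b j) = (q a b (j - i))%:E.

Definition lincomb_cov (x : 'cV[R]_m) (r : int) : R :=
  \sum_a x a 0 * \sum_b x b 0 * q a b r.

Lemma covariance_lincomb (x : 'cV[R]_m) i j :
  covariance P (fun w => \sum_a x a 0 * X a i w)
               (fun w => \sum_a x a 0 * X a j w) = (lincomb_cov x (j - i))%:E.
Proof.
rewrite covariance_suml ?Lfun2_sum// -sumEFin; apply: eq_bigr => a _.
rewrite EFinM covarianceC covariance_suml// -sumEFin; congr (_ * _)%E.
by apply: eq_bigr => b _; rewrite EFinM covarianceC Xcov.
Qed.

Lemma summable_lincomb_cov (u : nat -> R) (x : 'cV[R]_m) :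
    (forall k, 0 <= u k) -> (forall a b (r : int), `|q a b r| <= u `|r|%N) ->
    (\sum_(k <oo) (u k)%:E < +oo)%E ->
  summable [set: int] (EFin \o lincomb_cov x).
Proof.
move=> u0 qu ufin.
(* The square of the l1 norm of [x], produced by the triangle inequality in both sums. *)
pose C := \sum_a `|x a 0| * \sum_b `|x b 0|.
apply: (@summable_dominated_int _ _ (fun k => C * u k)) => [r|].
  rewrite /lincomb_cov /C (le_trans (ler_norm_sum _ _ _))// mulr_suml.
  apply: ler_sum => a _; rewrite normrM -mulrA ler_wpM2l//.
  rewrite (le_trans (ler_norm_sum _ _ _))// mulr_suml.
  by apply: ler_sum => b _; rewrite normrM ler_wpM2l.
under eq_eseriesr do rewrite EFinM.
rewrite nneseriesZl//; last by move=> k _; rewrite lee_fin.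
by rewrite lte_mul_pinfty// lee_fin sumr_ge0// => a _; rewrite mulr_ge0// sumr_ge0.
Qed.

End second_order_stationary.

Lemma measurable_cornerLe (R : realType) (d : nat) (c : corner d)
  (p : d.-tuple R) : measurable (cornerLe c p).
Proof.
rewrite (_ : cornerLe c p = \bigcap_(k in [set: 'I_d])
   ((fun s : d.-tuple R => tnth s k) @^-1`
     (`[0, 1]%classic `&` (if c k then `[tnth p k, +oo[%classic else `]-oo, tnth p k]%classic)))).
  apply: fin_bigcap_measurable => // k _.
  rewrite -[X in measurable X]setTI; apply: measurable_tnth => //.
  by apply: measurableI => //; case: (c k).
apply/seteqP; split=> [s [s01 sc] k _|s sk].
  split; first by rewrite /= in_itv/= s01.
  by have := sc k; case: (c k) => /=; rewrite in_itv/= ?andbT.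
split=> k; have [] := sk k I; rewrite /= in_itv/=; first by [].
by move=> _; case: (c k) => /=; rewrite in_itv/= ?andbT.
Qed.

(** * Consequences of strict stationarity and strong mixing for pairs of times *)

Section mixing.
Context (dT : measure_display) (T : measurableType dT) (R : realType).
Context (P : probability T R).
Context (dV : measure_display) (V : measurableType dV).
Variable Y : int -> {RV P >-> V}.

(** This is stationarity for the two times [0] and [j - i], shifted by [i]. *)
Lemma strictly_stationary_pair (A B : set V) (i j : int) :
    strictly_stationary Y -> measurable A -> measurable B ->
  P (Y i @^-1` A `&` Y j @^-1` B) = P (Y 0 @^-1` A `&` Y (j - i) @^-1` B).
Proof.
move=> Ystat mA mB.
have mAB : measurable [set t : 2.-tuple V | A (tnth t 0) /\ B (tnth t 1)].
  by apply: measurableI; rewrite -[X in measurable X]setTI;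
    apply: measurable_tnth.
have := Ystat 2%N [tuple 0; j - i] i _ mAB.
rewrite (_ : [set w | _] = Y i @^-1` A `&` Y j @^-1` B); last first.
  by apply/seteqP; split=> w /=; rewrite !tnth_mktuple/= !(tnth_nth 0)/= add0r subrK.
rewrite (_ : [set w | _] = Y 0 @^-1` A `&` Y (j - i) @^-1` B)//.
by apply/seteqP; split=> w /=; rewrite !tnth_mktuple/= !(tnth_nth 0)/=.
Qed.

Lemma strictly_stationary1 (A : set V) (i : int) :
  strictly_stationary Y -> measurable A -> P (Y i @^-1` A) = P (Y 0 @^-1` A).
Proof.
move=> Ystat mA; have := strictly_stationary_pair i i Ystat mA measurableT.
by rewrite !preimage_setT !setIT.
Qed.

Lemma sigma_of_preimage (I : set int) (i : int) (A : set V) : I i ->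
  measurable A -> sigma_of I Y (Y i @^-1` A).
Proof.
move=> Ii mA; apply: sub_sigma_algebra; exists i => //.
by exists A => //; rewrite setTI.
Qed.

(** The first event belongs to the past up to [i], the second to the future from [i + r], so the two
    nested suprema dominate this pair. *)
Lemma alpha_mixing_ge (A B : set V) (i : int) (r : nat) :
    measurable A -> measurable B ->
  (`|P (Y i @^-1` A `&` Y (i + r%:Z) @^-1` B) -
     P (Y i @^-1` A) * P (Y (i + r%:Z) @^-1` B)| <= alpha_mixing Y r)%E.
Proof.
move=> mA mB; apply: (@le_trans _ _
    (alpha_dep P (sigma_of [set k | k <= i] Y) (sigma_of [set k | i + r%:Z <= k] Y))).
  apply: ereal_sup_ubound; exists (Y i @^-1` A).
    by apply: sigma_of_preimage => //=.
  by exists (Y (i + r%:Z) @^-1` B) => //; apply: sigma_of_preimage => //=.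
by apply: ereal_sup_ubound; exists i.
Qed.

Lemma alpha_mixing_bound (phi : nat -> R) (A B : set V) (r : int) :
    (forall r : nat, (1 <= r)%N -> (alpha_mixing Y r <= (phi r)%:E)%E) ->
    r != 0 -> measurable A -> measurable B ->
  (`|P (Y 0 @^-1` A `&` Y r @^-1` B) - P (Y 0 @^-1` A) * P (Y r @^-1` B)|
     <= (phi `|r|%N)%:E)%E.
Proof.
move=> Ymix r0 mA mB.
have r1 : (1 <= `|r|)%N by rewrite absz_gt0.
apply: le_trans (Ymix _ r1).
have [rge0|rlt0] := leP 0 r.
  have := @alpha_mixing_ge A B 0 `|r|%N mA mB.
  by rewrite add0r gez0_abs.
(* For a negative lag, time [r] is the past and time [0] the future, so the two events trade
   places. *)
have := @alpha_mixing_ge B A r `|r|%N mB mA.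
by rewrite ltz0_abs// subrr setIC muleC.
Qed.

End mixing.

Theorem theorem3p16 (dT : measure_display) (T : measurableType dT)
    (R : realType) (P : probability T R) (d : nat) (d_ge1 : (1 <= d)%N)
    (Y : int -> {RV P >-> d.-tuple R})
    (Y_stationary : strictly_stationary Y)
    (Y_uniform : forall (i : int) (A : set (d.-tuple R)), measurable A ->
       distribution P (Y i) A = uniform_cube R d A)
    (phi : nat -> R) (phi_ge0 : forall r, 0 <= phi r)
    (phi_sum : (\sum_(0 <= r <oo) (r%:R * phi r)%:E < +oo)%E)
    (Y_mixing : forall r : nat, (1 <= r)%N -> (alpha_mixing Y r <= (phi r)%:E)%E)
    (m : nat) (c : 'I_m -> corner d) (p : 'I_m -> d.-tuple R)
    (p_cube : forall a, cube (p a)) :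
  let S := longrun_cov Y c p in
  [/\ forall a b, summable [set: int] (xi_cov Y c p a b),
      forall x : 'cV[R]_m,
        [/\ summable [set: int] (autocov Y c p x),
            ((n%:R^-1)%:E *
               'V_P[fun w => (\sum_(i < n) Zproc Y c p x i%:Z w)%R])%E
              @[n --> \oo] --> zsum (autocov Y c p x),
            zsum (autocov Y c p x) = ((x^T *m S *m x) 0 0)%:E
          & 0 <= (x^T *m S *m x) 0 0]
    & psd S].
Proof.
pose A a i := Y i @^-1` cornerLe (c a) (p a).
pose X a i w : R := xi (c a) (p a) (Y i w).
have mA a i : measurable (A a i).
  by rewrite /A; apply: measurable_funPTI; exact: measurable_cornerLe.
have XE a i : X a i = (\1_(A a i) \- cst (cornerF (c a) (p a)))%R by [].
have XL a i : X a i \in Lfun P 2%:E.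
  by rewrite XE rpredB//= ?lee1n ?Lfun_cst ?Lfun2_indic.
have covE a b i j : covariance P (X a i) (X b j) =
    (P (A a i `&` A b j) - P (A a i) * P (A b j))%E.
  exact: (covariance_indicB P _ _ (mA a i) (mA b j)).
pose q a b r := fine (xi_cov Y c p a b r).
have qE a b r : xi_cov Y c p a b r = (q a b r)%:E.
  rewrite /q fineK// [_ a b r](covE a b 0 r).
  by rewrite fin_numB fin_numM ?fin_num_measure//; exact: measurableI.
(* Weak stationarity: once the covariance is written with probabilities, strict stationarity moves
   time [i] to [0]. *)
have Xcov a b i j : covariance P (X a i) (X b j) = (q a b (j - i))%:E.
  rewrite -qE [RHS](covE a b 0) covE.
  rewrite /A (strictly_stationary_pair i j)//; try exact: measurable_cornerLe.
  congr (_ - _ * _)%E.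
  - by rewrite strictly_stationary1//; exact: measurable_cornerLe.
  - by rewrite [LHS]strictly_stationary1 ?[RHS]strictly_stationary1//;
      exact: measurable_cornerLe.
(* Reversing the lag exchanges the two indices; this is where the symmetry of [S] comes from. *)
have qN a b r : q a b (- r) = q b a r.
  by apply: EFin_inj; rewrite -[- r]sub0r -Xcov covarianceC Xcov subr0.
(* [phi 0] is not controlled by the hypotheses and is discarded. *)
pose u k : R := if k == 0%N then 1 + 1 else k%:R * phi k.
have u0 k : 0 <= u k by rewrite /u; case: ifP => _; rewrite ?mulr_ge0.
(* At lag [0] both terms of the difference are at most 1, giving [1 + 1]. At any other lag mixing
   gives [phi], and the factor [|r|] is at least 1. *)
have qu a b (r : int) : `|q a b r| <= u `|r|%N.
  rewrite -lee_fin -abse_EFin -qE [_ a b r](covE a b 0 r) /u absz_eq0.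
  have [->|r0] := eqVneq r 0.
    rewrite (le_trans (lee_abs_sub _ _))// EFinD.
    rewrite abseM !gee0_abs// leeD ?probability_le1//; first exact: measurableI.
    by rewrite -[leRHS]mule1 lee_pmul ?probability_le1.
  apply: le_trans (alpha_mixing_bound Y_mixing r0 _ _) _;
    try exact: measurable_cornerLe.
  rewrite lee_fin -[leLHS]mul1r ler_wpM2r// ler1n absz_gt0//.
(* Split off the terms of index 0, a finite one for [u] and a zero one in [phi_sum]; the remaining
   terms agree. *)
have ufin : (\sum_(k <oo) (u k)%:E < +oo)%E.
  rewrite nneseries_recl//; last by move=> k _; rewrite lee_fin.
  rewrite lte_add_pinfty ?ltry//; apply: le_lt_trans phi_sum.
  rewrite [leRHS]nneseries_recl//; last by move=> k _; rewrite lee_fin mulr_ge0.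
  rewrite mul0r add0e -(nneseries_addn 1 (f := EFin \o u))//.
  rewrite -(nneseries_addn 1 (f := fun k => (k%:R * phi k)%:E))//; last first.
    by move=> k; rewrite lee_fin mulr_ge0.
  by apply: lee_nneseries => k; rewrite ?lee_fin// addn1 /= /u.
move=> S.
have covS a b : summable [set: int] (EFin \o q a b).
  exact: summable_dominated_int (qu a b) ufin.
have xi_covE a b : xi_cov Y c p a b = EFin \o q a b by apply/funext => r; exact: qE.
have S_lim a b : symsum (q a b) n @[n --> \oo] --> S a b.
  by rewrite mxE xi_covE; have [] := cvg_symsum (covS a b).
(* By [qN], the transposed entries are limits of the same sequence of symmetric partial sums. *)
have S_sym : S^T = S.
  apply/matrixP => a b; rewrite mxE; apply: cvg_unique (S_lim b a) _ => //.
  suff -> : symsum (q b a) = symsum (q a b) by exact: S_lim.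
  by apply/funext => n; exact: symsumN (qN b a).
have autocovE x : autocov Y c p x = EFin \o lincomb_cov q x.
  apply/funext => r; rewrite /= -[r in RHS]subr0.
  exact: (covariance_lincomb XL Xcov x 0 r).
have lincomb_sum x : summable [set: int] (EFin \o lincomb_cov q x).
  exact: summable_lincomb_cov u0 qu ufin.
have ZL (x : 'cV[R]_m) i : Zproc Y c p x i \in Lfun P 2%:E.
  exact: (Lfun2_sum _ (fun a => x a 0) (XL ^~ i)).
have Zcov (x : 'cV[R]_m) i j : covariance P (Zproc Y c p x i) (Zproc Y c p x j) =
    (lincomb_cov q x (j - i))%:E by
  exact: (covariance_lincomb XL Xcov).
have quadE (x : 'cV[R]_m) : (x^T *m S *m x) 0 0 = \sum_a x a 0 * \sum_b x b 0 * S a b.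
  rewrite -mulmxA mxE; apply: eq_bigr => a _; rewrite !mxE; congr (_ * _).
  by apply: eq_bigr => b _; rewrite mulrC.
(* Both sides are limits of the symmetric partial sums of [lincomb_cov q x], since the finite sums
   over [a] and [b] commute with the limit. *)
have zsumE x : zsum (autocov Y c p x) = ((x^T *m S *m x) 0 0)%:E.
  have [lim_x fin_x] := cvg_symsum (lincomb_sum x).
  rewrite autocovE -(fineK fin_x); congr EFin.
  apply: cvg_unique lim_x _ => //.
  rewrite quadE (_ : symsum _ =
      fun n => \sum_a x a 0 * \sum_b x b 0 * symsum (q a b) n); last first.
    apply/funext => n; rewrite symsum_sum.
    by apply: eq_bigr => a _; rewrite symsum_sum.
  by apply: cvg_weighted_sum => a; exact: cvg_weighted_sum.
have V_lim x : ((n%:R^-1)%:E *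
    'V_P[fun w => (\sum_(i < n) Zproc Y c p x i%:Z w)%R])%E
    @[n --> \oo] --> zsum (autocov Y c p x).
  rewrite autocovE; exact: variance_partial_sums (ZL x) (Zcov x) (lincomb_sum x).
have S_ge0 (x : 'cV[R]_m) : 0 <= (x^T *m S *m x) 0 0.
  rewrite -lee_fin -zsumE -(cvg_lim _ (V_lim x))//; apply: lime_ge.
    by apply/cvg_ex; exists (zsum (autocov Y c p x)); exact: V_lim.
  (* The bound holds for every [n], including [0], whose inverse is [0] by convention. *)
  by apply: nearW => n; rewrite mule_ge0 ?variance_ge0// lee_fin.
split=> [a b|x|//]; first by rewrite xi_covE.
by split=> //; rewrite autocovE.
Qed.
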